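(* Let $\lambda\in\mathbb{R}$, let $Y$ be a random variable whose moment generating function exists in a neighborhood of the origin, and let $x\in[0,1]$ with $(x)_{k,\lambda}\neq0$. For all integers $n\ge k\ge 0$, \[ \mathcal{E}_{n-k,\lambda}^{Y}(1-x)=\sum_{l=k}^{n}\frac{\binom{n}{l}}{\binom{n}{k}\binom{x}{k}_{\lambda}}\,\mathcal{E}_{n-l,\lambda}^{Y}\,\frac{B_{k,l}^{Y}(x|\lambda)}{k!}. \]
   Context: For $\lambda\in\mathbb{R}$, $(x)_{0,\lambda}=1$, $(x)_{n,\lambda}=x(x-\lambda)\cdots(x-(n-1)\lambda)$ for $n\ge1$, $\binom{x}{k}_\lambda=\frac{(x)_{k,\lambda}}{k!}$, and $e_\lambda^x(t)=\sum_{n\ge0}(x)_{n,\lambda}\frac{t^n}{n!}$. For the random variable $Y$, $E[e_\lambda^Y(t)]$ denotes the power series $\sum_{n\ge0}E[(Y)_{n,\lambda}]\frac{t^n}{n!}$ (constant term $1$); for real $a$, $(E[e_\lambda^Y(t)])^a=\sum_{j\ge0}\binom{a}{j}(E[e_\lambda^Y(t)]-1)^j$. The probabilistic degenerate Euler polynomials: $\frac{2}{E[e_\lambda^Y(t)]+1}(E[e_\lambda^Y(t)])^x=\sum_{n\ge0}\mathcal{E}_{n,\lambda}^Y(x)\frac{t^n}{n!}$, and $\mathcal{E}_{n,\lambda}^Y=\mathcal{E}_{n,\lambda}^Y(0)$. The probabilistic degenerate Bernstein polynomials: $\frac{1}{k!}(x)_{k,\lambda}t^k(E[e_\lambda^Y(t)])^{1-x}=\sum_{n\ge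 k}B_{k,n}^{Y}(x|\lambda)\frac{t^n}{n!}$. *)

(* Defs.v *)
From HB Require Import structures.
From mathcomp Require Import all_boot all_order all_algebra.
From mathcomp Require Import all_classical all_reals all_analysis.

Set Implicit Arguments.
Unset Strict Implicit.
Unset Printing Implicit Defensive.

Import Order.TTheory GRing.Theory Num.Theory.
Import numFieldNormedType.Exports.

Local Open Scope ring_scope.

(* Formal power series in t, as the sequence of their coefficients of t^n.
   The product is the Cauchy product, not the pointwise product that the
   library puts on nat -> R. *)
Definition fps (R : Type) := nat -> R.

Section FormalPowerSeries.
Variable R : fieldType.
Implicit Types (f g : fps R) (c : R).

Definition fpsC c : fps R := fun n => if n == 0%N then c else 0.

Definition fpsX : fps R := fun n => (n == 1%N)%:R.

Definition fpsD f g : fps R := fun n => f n + g n.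

Definition fpsB f g : fps R := fun n => f n - g n.

Definition fpsM f g : fps R := fun n => \sum_(i < n.+1) f i * g (n - i)%N.

Definition fpsXn f (j : nat) : fps R := iter j (fpsM f) (fpsC 1).

(* The series \sum_(j >= 0) a j * g^j, for g without constant term: the
   coefficient of t^n in g^j is then 0 for j > n (lemma fpsXn_eq0). *)
Definition fps_comp (a : nat -> R) g : fps R :=
  fun n => \sum_(j < n.+1) a j * fpsXn g j n.

(* With f = f0 * (1 - g) and f0 != 0, 1/f = f0^-1 * \sum_(j >= 0) g^j;
   lemma fpsMV. *)
Definition fpsV f : fps R :=
  fpsM (fpsC (f 0%N)^-1)
    (fps_comp (fun=> 1) (fpsB (fpsC 1) (fpsM (fpsC (f 0%N)^-1) f))).

Lemma fpsCM c f n : fpsM (fpsC c) f n = c * f n.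
Proof.
rewrite /fpsM big_ord_recl /= subn0 big1 ?addr0 // => i _.
by rewrite /fpsC /= mul0r.
Qed.

Lemma fpsXn_eq0 g j n : g 0%N = 0 -> (n < j)%N -> fpsXn g j n = 0.
Proof.
move=> g0; elim: j n => [//|j IH] n lt_nj; rewrite /fpsXn iterS.
rewrite /fpsM big1 // => -[[|i] lt_i] _ /=; first by rewrite g0 mul0r.
rewrite -/(fpsXn g j) IH ?mulr0 //.
by rewrite (leq_trans _ (lt_nj : (n <= j)%N)) // subnS prednK ?subn_gt0 // leq_subr.
Qed.

Lemma fps_compE (a : nat -> R) g n N : g 0%N = 0 -> (n < N)%N ->
  fps_comp a g n = \sum_(j < N) a j * fpsXn g j n.
Proof.
move=> g0 lt_nN; rewrite /fps_comp.
rewrite (big_ord_widen N (fun j => a j * fpsXn g j n)) //.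
rewrite big_mkcond; apply: eq_bigr => j _; case: ltnP => // lt_nj.
by rewrite fpsXn_eq0 ?mulr0.
Qed.

Lemma fpsMV f : f 0%N != 0 -> fpsM f (fpsV f) = fpsC 1.
Proof.
move=> f0; apply/funext => n.
set g := fpsB (fpsC 1) (fpsM (fpsC (f 0%N)^-1) f).
have g0 : g 0%N = 0 by rewrite /g /fpsB fpsCM /fpsC /= mulVf // subrr.
set S := fps_comp (fun=> 1) g.
have SE m : S m = fpsC 1 m + fpsM g S m.
  rewrite {1}/S (@fps_compE _ _ _ m.+2) // big_ord_recl /= mul1r.
  congr (_ + _); rewrite /fpsM.
  have -> : \sum_(i < m.+1) g i * S (m - i)%N =
      \sum_(i < m.+1) \sum_(j < m.+1) g i * fpsXn g j (m - i)%N.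
    apply: eq_bigr => i _; rewrite -mulr_sumr; congr (_ * _).
    rewrite /S (@fps_compE _ _ _ m.+1) ?ltnS ?leq_subr //.
    by apply: eq_bigr => j _; rewrite mul1r.
  by rewrite exchange_big /=; apply: eq_bigr => j _; rewrite mul1r.
have -> : fpsM f (fpsV f) n = S n - fpsM g S n.
  rewrite -[S n]mul1r -fpsCM /fpsM -sumrB; apply: eq_bigr => i _.
  rewrite /fpsV fpsCM -/g -/S -mulrBl mulrA; congr (_ * _).
  by rewrite /g /fpsB fpsCM opprB addrC subrK mulrC.
by rewrite SE addrK.
Qed.

End FormalPowerSeries.

Definition dfact (R : fieldType) (lambda x : R) (n : nat) : R :=
  \prod_(i < n) (x - i%:R * lambda).

(* For lambda = 1 this is the generalized binomial coefficient. *)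
Definition dbinom (R : fieldType) (lambda x : R) (k : nat) : R :=
  dfact lambda x k / k`!%:R.

Definition fps_powr (R : fieldType) (f : fps R) (a : R) : fps R :=
  fps_comp (dbinom 1 a) (fpsB f (fpsC 1)).

Definition egf_coef (R : fieldType) (f : fps R) (n : nat) : R := n`!%:R * f n.

Section ProbabilisticDegenerate.
Context (d : measure_display) (T : measurableType d) (R : realType).
Context (P : probability T R) (Y : {RV P >-> R}) (lambda : R).

(* 'E_P[_] is extended-real valued; the expectations below are finite as soon
   as the moment generating function of Y is finite near 0. *)
Definition dexp_expectation : fps R :=
  fun n => fine ('E_P[fun w => dfact lambda (Y w) n])%E / n`!%:R.

Definition prob_dEuler (n : nat) (x : R) : R :=
  egf_coef
    (fpsM (fpsM (fpsC 2) (fpsV (fpsD dexp_expectation (fpsC 1))))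
          (fps_powr dexp_expectation x)) n.

Definition prob_dBernstein (k n : nat) (x : R) : R :=
  egf_coef
    (fpsM (fpsM (fpsC (1 / k`!%:R * dfact lambda x k)) (fpsXn (fpsX R) k))
          (fps_powr dexp_expectation (1 - x))) n.

Lemma dexp_expectation0 : dexp_expectation 0%N = 1.
Proof.
rewrite /dexp_expectation (_ : (fun w => _) = cst 1); last first.
  by apply/funext => w; rewrite /dfact big_ord0.
by rewrite expectation_cst /= divr1.
Qed.

End ProbabilisticDegenerate.

(* Main.v *)
Require Import Defs.
From HB Require Import structures.
From mathcomp Require Import all_boot all_order all_algebra.
From mathcomp Require Import all_classical all_reals all_analysis.
From mathcomp Require Import ring.

Import Order.TTheory GRing.Theory Num.Theory.
Import numFieldNormedType.Exports.

Local Open Scope ring_scope.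

(* Writing [F := E[e_lambda^Y(t)]], both sides are the coefficient of [t^(n-k)]
   in [2 / (F + 1) * F^(1-x)], up to factorials: the Bernstein generating
   function is [F^(1-x)] shifted by [t^k] and scaled by [dbinom lambda x k], and
   [F^0 = 1] makes [2 / (F + 1)] the generating function of the Euler numbers. *)

Section FormalPowerSeriesTheory.
Variable R : fieldType.
Implicit Types (f : fps R) (c : R).

Lemma fpsM1 f n : fpsM f (fpsC 1) n = f n.
Proof.
rewrite /fpsM big_ord_recr /= subnn /fpsC /= mulr1 big1 ?add0r // => i _.
by rewrite subn_eq0 leqNgt ltn_ord mulr0.
Qed.

Lemma fpsXM f n : fpsM (fpsX R) f n = if n is m.+1 then f m else 0.
Proof.
rewrite /fpsM /fpsX big_ord_recl /= mul0r add0r.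
case: n => [|n]; first by rewrite big_ord0.
rewrite big_ord_recl /= mul1r subSS subn0 big1 ?addr0 // => i _.
by rewrite /bump /= mul0r.
Qed.

Lemma fpsXn_X k n : fpsXn (fpsX R) k n = (n == k)%:R.
Proof.
elim: k n => [|k IH] n; first by rewrite /fpsXn /= /fpsC; case: (n == 0%N).
by rewrite /fpsXn iterS fpsXM; case: n => // n; rewrite -/(fpsXn _ k) IH.
Qed.

(** The left factor is a monomial, so only index [k] of the outer Cauchy product survives; [k <= n]
    puts that index in range. *)
Lemma fpsCXnM c k f n : (k <= n)%N ->
  fpsM (fpsM (fpsC c) (fpsXn (fpsX R) k)) f n = c * f (n - k)%N.
Proof.
move=> le_kn; have lt_kn : (k < n.+1)%N by [].
rewrite {1}/fpsM (bigD1 (Ordinal lt_kn)) //= fpsCM fpsXn_X eqxx mulr1.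
rewrite big1 ?addr0 // => i neq_ik; have /negPf ik_F : (i : nat) != k := neq_ik.
by rewrite fpsCM fpsXn_X ik_F mulr0 mul0r.
Qed.

Lemma fps_powr0 f : fps_powr f 0 = fpsC 1.
Proof.
apply/funext => n; rewrite /fps_powr /fps_comp big_ord_recl /=.
rewrite /dbinom {1}/dfact big_ord0 divr1 mul1r big1 ?addr0 // => i _.
(* For positive length, the falling factorial of 0 has first factor [0 - 0 * 1]. *)
by rewrite /dfact big_ord_recl /= mul0r subr0 !mul0r.
Qed.

End FormalPowerSeriesTheory.

Theorem theorem2p5 (d : measure_display) (T : measurableType d) (R : realType)
    (P : probability T R) (Y : {RV P >-> R}) (lambda x : R) (n k : nat)
    (mgfY : \forall t \near (0 : R), ('M_P Y t < +oo)%E)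
    (x01 : 0 <= x <= 1)
    (xk : dfact lambda x k != 0)
    (kn : (k <= n)%N) :
  prob_dEuler Y lambda (n - k) (1 - x) =
  \sum_(k <= l < n.+1)
    'C(n, l)%:R / ('C(n, k)%:R * dbinom lambda x k)
    * prob_dEuler Y lambda (n - l) 0
    * (prob_dBernstein Y lambda k l x / k`!%:R).
Proof.
rewrite /prob_dEuler /prob_dBernstein fps_powr0 /egf_coef.
set A := fpsM (fpsC 2) _; set F := fps_powr _ _.
have fact_neq0 m : m`!%:R != 0 :> R by rewrite pnatr_eq0 -lt0n fact_gt0.
have bin_fact_R m : (m <= n)%N ->
    'C(n, m)%:R = n`!%:R / (m`!%:R * (n - m)`!%:R) :> R.
  by move=> le_mn; rewrite -(bin_fact le_mn) !natrM mulfK // mulf_neq0.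
(* With [l = i + k] both sums run over [i <= n - k]. Reversing the Cauchy product then makes both
   sides pair [A (n - l)] with [F (l - k)]. *)
rewrite (big_addn 0 n.+1 k) subSn // big_mkord [fpsM A F _]/fpsM mulr_sumr.
rewrite (reindex_inj rev_ord_inj) /=; apply: eq_bigr => i _.
have le_ink : (i <= n - k)%N by rewrite -ltnS.
have le_ikn : (i + k <= n)%N by rewrite addnC -leq_subRL.
rewrite fpsM1 fpsCXnM ?leq_addl // addnK subSS subKn // !bin_fact_R // /dbinom.
rewrite -subnDA [(k + i)%N]addnC.
(* For [l = i + k], the ratio of binomials is k! (n-k)! / (l! (n-l)!). The factors l! and (n-l)!
   come back from [egf_coef], k! cancels the division of the Bernstein term, and [dbinom lambda x k]
   cancels its scaling. *)
field.
by rewrite xk !fact_neq0.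
Qed.
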